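(* Let $X$ be a nonempty set. If $k$ is a finite field of characteristic $p>2$, then $k\langle X\rangle$ has infinitely many maximal $T$-spaces.
   Context: $k\langle X\rangle$ denotes the free unitary associative $k$-algebra on $X$. A $T$-space of $k\langle X\rangle$ is a $k$-linear subspace invariant under every (unitary) $k$-algebra endomorphism of $k\langle X\rangle$. A maximal $T$-space is a maximal element, under inclusion, among the proper $T$-spaces. *)

(* Defs.v *)
From mathcomp Require Import all_boot all_algebra.
From mathcomp Require Import boolp classical_sets cardinality.
From mathcomp Require Import monalg.

Set Implicit Arguments.
Unset Strict Implicit.
Unset Printing Implicit Defensive.

Import GRing.Theory.

Local Open Scope classical_set_scope.
Local Open Scope ring_scope.

(* The monoid algebra over k of the free monoid {fmonom X} of words on X. *)
Notation free_algebra k X := {malg k[{fmonom X}]}.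

Definition is_Tspace (k : fieldType) (X : choiceType)
    (V : set (free_algebra k X)) : Prop :=
  GRing.submod_closed (mem V) /\
  forall f : {lrmorphism free_algebra k X -> free_algebra k X}, f @` V `<=` V.

Definition is_proper_Tspace (k : fieldType) (X : choiceType)
    (V : set (free_algebra k X)) : Prop :=
  is_Tspace V /\ V <> setT.

Definition is_maximal_Tspace (k : fieldType) (X : choiceType)
    (V : set (free_algebra k X)) : Prop :=
  is_proper_Tspace V /\
  forall W : set (free_algebra k X),
    is_proper_Tspace W -> V `<=` W -> W = V.

(* Main.v *)
Require Import Defs.
From mathcomp Require Import all_boot all_algebra.
From mathcomp Require Import boolp classical_sets cardinality.
From mathcomp Require Import monalg.
From HB Require Import structures.
From mathcomp Require Import ring finfield.

(** Let q be the order of k.  Elements of the free algebra can be evaluated at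
    families of elements of a finite extension of k.  For n > 0, those whose
    values on the field with q ^ (2 n) elements all lie in its subfield with
    q ^ n elements form a proper T-space V_n: no letter is among them.  Now
    let m > 0 be a multiple of 2 n.  Every u splits as

      u = (u - u ^ (q ^ m)) / 2  +  (u + u ^ (q ^ m)) / 2,

    which is where odd characteristic is used.  The first summand vanishes on
    the field with q ^ (2 n) elements, because m is a multiple of 2 n; so it
    lies in V_n.  The second is half a trace from the field with q ^ (2 m)
    elements to the one with q ^ m elements; so it lies in V_m.  Hence
    V_n + V_m is everything, and no proper subspace contains both V_n and V_m.

    Each letter generates the whole free algebra as a T-space, so Zorn's lemma
    puts every proper T-space inside a maximal one
    ([proper_Tspace_sub_maximal]).  Taking n = 1, 2, 4, 8, ... gives pairwise
    comaximal proper T-spaces, and the maximal T-spaces above them are pairwise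
    distinct ([comaximal_infinite_maximal_Tspaces]).

    The finite fields are never constructed.  An element of a commutative
    k-algebra fixed by the q ^ N-th power map is the same thing as an algebra
    map from k[t] / (t ^ (q ^ N) - t), so the condition defining V_n is
    expressed as a divisibility by t ^ (q ^ (2 n)) - t between polynomials, and
    only Frobenius identities in k[t] remain to be checked. *)

Import GRing.Theory.

Set Implicit Arguments.
Unset Strict Implicit.
Unset Printing Implicit Defensive.

Local Open Scope classical_set_scope.
Local Open Scope ring_scope.

(** * The universal property of the free algebra *)

Section Universal.
Context (X : choiceType) (k : fieldType).

Definition letter (x : X) : free_algebra k X := << fmu x >>.

Section Eval.
Context (A : lalgType k) (a : X -> A).

Definition eval_word (m : {fmonom X}) : A := \prod_(x <- m : seq X) a x.

Lemma eval_word_mmorphism : mmorphism eval_word.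
Proof.
split=> [m1 m2|]; rewrite /eval_word; first by rewrite fmM big_cat.
by rewrite fm1 big_nil.
Qed.

HB.instance Definition _ := isMultiplicative.Build {fmonom X} A eval_word
  eval_word_mmorphism.

Definition eval_free : free_algebra k X -> A := mmap (in_alg A) eval_word.

Hypothesis scalar_central : forall (c : k) (u : A), GRing.comm c%:A u.

Lemma eval_free_is_multiplicative : monoid_morphism eval_free.
Proof.
have [f_mul f1] := @commr_mmap_is_multiplicative _ _ _ (in_alg A) eval_word
  (fun g m m' => scalar_central _ _).
by split.
Qed.

Lemma eval_free_is_linear : linear eval_free.
Proof.
by move=> c f g; rewrite /eval_free mmapD mmapZ /= -scalerAl mul1r.
Qed.

(** Scalars have to be central in [A] for evaluation to be multiplicative.
    This is a hypothesis, not part of the type of [A], so that the lemma covers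
    both a commutative target and the free algebra itself, whose structure is
    only that of a left algebra. *)
Lemma free_algebra_universal :
  {phi : {lrmorphism free_algebra k X -> A} | forall x, phi (letter x) = a x}.
Proof.
pose m :=
  GRing.isMonoidMorphism.Build _ _ eval_free eval_free_is_multiplicative.
pose l := GRing.isLinear.Build k _ _ *:%R eval_free eval_free_is_linear.
pose phi : {lrmorphism free_algebra k X -> A} := HB.pack eval_free m l.
exists phi => x; rewrite /= /eval_free mmapU /eval_word fmU big_seq1.
by rewrite /= scale1r mul1r.
Qed.
End Eval.

Lemma free_algebra_scalar_central (c : k) (u : free_algebra k X) :
  GRing.comm c%:A u.
Proof.
have -> : c%:A = malgC c :> free_algebra k X by rewrite -mul_malgC mulr1.
rewrite /GRing.comm mul_malgC malgZ_def malgM_def fgmulgU.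
by apply: eq_bigr => m _; rewrite mulm1 mulrC.
Qed.
End Universal.
Arguments letter {X} k x.

(** * Frobenius powers of polynomials over a finite field *)

Section Poly.
Context (k : finFieldType).
Implicit Types (f g : {poly k}).

Lemma card_pchar_nat n : [pchar k].-nat (#|k| ^ n)%N.
Proof.
have [p p_pr pk] := finPcharP k.
have -> : #|k| = (p ^ logn p #|k|)%N by exact: card_pprimeChar pk.
by rewrite -expnM pnatX pnatE // pk.
Qed.

(** The q ^ n-th power map is additive and, by Fermat, fixes the coefficients;
    so it only acts on the variable.  Unlike a power, the composition on the
    right is visibly linear in [f]. *)
Lemma expX_card_comp n f : f ^+ (#|k| ^ n) = f \Po 'X^(#|k| ^ n).
Proof.
have fermat c : c ^+ (#|k| ^ n) = c :> k.
  by elim: n => [|n IH]; rewrite ?expr1 // expnS exprM expf_card.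
elim/poly_ind: f => [|f c IH].
  by rewrite comp_poly0 expr0n expn_eq0 (gtn_eqF (ltnW (finNzRing_gt1 k))).
rewrite exprDn_pchar; last first.
  by rewrite (eq_pnat _ (pchar_poly k)) card_pchar_nat.
rewrite exprMn IH comp_polyD comp_polyM comp_polyX comp_polyC.
by rewrite -rmorphXn /= fermat.
Qed.

(** Modulo t ^ N - t, substituting t ^ N for t is the identity. *)
Lemma dvdp_XnsubX_comp N f : 'X^N - 'X %| (f \Po 'X^N) - f.
Proof.
elim/poly_ind: f => [|f c IH]; first by rewrite comp_poly0 subrr dvdp0.
have -> : (f * 'X + c%:P) \Po 'X^N - (f * 'X + c%:P)
  = (f \Po 'X^N - f) * 'X^N + f * ('X^N - 'X).
  rewrite comp_polyD comp_polyM comp_polyX comp_polyC; ring.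
by apply: dvdp_add; [apply: dvdp_mulr | apply: dvdp_mull].
Qed.

(** In terms of fields: the field with q ^ m elements is contained in the one
    with q ^ n elements when m divides n. *)
Lemma dvdp_Xpow_subX m n : (m %| n)%N ->
  'X^(#|k| ^ m) - 'X %| ('X^(#|k| ^ n) - 'X : {poly k}).
Proof.
case/dvdnP=> j ->; elim: j => [|j IH]; first by rewrite expr1 subrr dvdp0.
have := dvdp_add (dvdp_XnsubX_comp (#|k| ^ m) ('X^(#|k| ^ (j * m)))) IH.
by rewrite comp_Xn_poly -exprM -expnD addrA subrK -mulSn.
Qed.
End Poly.

(** * Maximal T-spaces above proper T-spaces *)

Section MaximalTspaces.
Context (X : choiceType) (k : fieldType).
Implicit Types (V W : set (free_algebra k X)).

(** A letter can be sent to any element by an endomorphism. *)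
Lemma Tspace_letter V (x : X) : is_Tspace V -> V (letter k x) -> V = setT.
Proof.
case=> _ V_endo Vx; apply/seteqP; split=> // u _.
have [phi phi_letter] := free_algebra_universal (fun _ : X => u)
  (@free_algebra_scalar_central X k).
by rewrite -(phi_letter x); apply: (V_endo phi); exists (letter k x).
Qed.

(** The union stays proper because properness is detected by a single element,
    a letter: it belongs to the union only if it belongs to a member. *)
Lemma bigcup_chain_proper_Tspace (hX : inhabited X)
    (I : Type) (D : set I) (V : I -> set (free_algebra k X)) :
  (exists i, D i) -> (forall i, D i -> is_proper_Tspace (V i)) ->
  (forall i j, D i -> D j -> V i `<=` V j \/ V j `<=` V i) ->
  is_proper_Tspace (\bigcup_(i in D) V i).
Proof.
case: hX => x [i0 Di0] V_proper V_chain.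
split; last first.
  move=> U_full.
  have [i Di Vix] : (\bigcup_(i in D) V i) (letter k x) by rewrite U_full.
  have [V_T V_neq] := V_proper _ Di.
  exact/V_neq/(Tspace_letter V_T Vix).
split; last first.
  move=> phi _ [u [i Di Viu] <-]; exists i => //.
  by have [[_ V_endo] _] := V_proper _ Di; apply: V_endo; exists u.
split.
  rewrite inE; exists i0 => //.
  by have [[[+ _] _] _] := V_proper _ Di0; rewrite inE.
move=> c u v; rewrite !inE => -[i Di Viu] [j Dj Vjv].
have [l [Dl Vlu Vlv]] : exists l, [/\ D l, V l u & V l v].
  have [le | le] := V_chain _ _ Di Dj.
    by exists j; split=> //; apply: le.
  by exists i; split=> //; apply: le.
have [[[_ Vl_lin] _] _] := V_proper _ Dl.
by exists l => //; have := Vl_lin c u v; rewrite !inE; apply.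
Qed.

Lemma proper_Tspace_sub_maximal (hX : inhabited X) V :
  is_proper_Tspace V -> exists2 M, is_maximal_Tspace M & V `<=` M.
Proof.
move=> V_proper.
(* Adjoining [V] makes the empty chain harmless: its union still yields the
   proper T-space [V]. *)
pose P W := is_proper_Tspace (V `|` W).
have [F F_P F_chain|A [PA A_max]] := @Zorn_bigcup _ P.
  have [->|/set0P F_neq0] := eqVneq F set0.
    by rewrite /P bigcup_set0 setU0.
  rewrite /P (_ : _ `|` _ = \bigcup_(W in F) (V `|` W)).
    apply: bigcup_chain_proper_Tspace => // W1 W2 FW1 FW2.
    by have [le|le] := F_chain _ _ FW1 FW2; [left | right]; apply: setUS.
  have [W0 FW0] := F_neq0.
  apply/seteqP; split=> [u [Vu|[W FW Wu]]|u [W FW [Vu|Wu]]].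
  - by exists W0 => //; left.
  - by exists W => //; right.
  - by left.
  - by right; exists W.
exists (V `|` A); last exact: subsetUl.
split=> // W W_proper VA_W; apply/seteqP; split=> // u Wu.
apply: contrapT => VA_u; apply: (A_max W).
  split=> [|W_A]; last by apply: VA_u; right; apply: W_A.
  by move=> v Av; apply: VA_W; right.
rewrite /P (_ : V `|` W = W) //; apply/setUidPr => v Vv.
by apply: VA_W; left.
Qed.

(** Two of the spaces never fit in one proper subspace, so maximal T-spaces
    chosen above them cannot coincide. *)
Lemma comaximal_infinite_maximal_Tspaces (hX : inhabited X)
    (V : nat -> set (free_algebra k X)) :
  (forall i, is_proper_Tspace (V i)) ->
  (forall i j, (i < j)%N -> forall u, exists2 v, V i v & V j (u - v)) ->
  infinite_set [set M : set (free_algebra k X) | is_maximal_Tspace M].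
Proof.
move=> V_proper V_comax.
have /choice[M /all_and2[M_max V_M]] i :
    exists M, is_maximal_Tspace M /\ V i `<=` M.
  by have [M ? ?] := proper_Tspace_sub_maximal hX (V_proper i); exists M.
have M_neq i j : (i < j)%N -> M i <> M j.
  move=> lt_ij eq_M; have [[[[_ M_lin] _] M_neqT] _] := M_max j.
  apply: M_neqT; apply/seteqP; split=> // u _.
  have [v /V_M Mv /V_M Mw] := V_comax _ _ lt_ij u.
  rewrite eq_M in Mv.
  by have := M_lin 1 (u - v) v; rewrite !inE scale1r subrK; apply.
have M_inj : injective M.
  move=> i j eq_M; apply/eqP; case: ltngtP => // /M_neq; first by case.
  by case; rewrite eq_M.
move=> fin_max; apply: infinite_nat.
have := finite_preimage (f := M) (in2W M_inj) fin_max.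
by apply: sub_finite_set => i _; apply: M_max.
Qed.
End MaximalTspaces.

(** * Comaximal T-spaces from quadratic extensions of finite fields *)

Section FrobeniusFixed.
Context (X : choiceType) (k : finFieldType).
Local Notation q := #|k|.

(** The elements whose values on the field with q ^ (2 n) elements are fixed by
    the q ^ n-th power map.  Modulo t ^ (q ^ (2 n)) - t the maps [phi] are the
    evaluations in a product of subfields of that field, the field itself
    included, and composition with t ^ (q ^ n) is the q ^ n-th power map. *)
Definition frobenius_fixed (n : nat) : set (free_algebra k X) :=
  [set u | forall phi : {lrmorphism free_algebra k X -> {poly k}},
    'X^(q ^ (2 * n)) - 'X %| (phi u \Po 'X^(q ^ n)) - phi u].

Lemma frobenius_fixed_Tspace n : is_Tspace (frobenius_fixed n).
Proof.
split; first split.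
- by rewrite inE => phi; rewrite rmorph0 comp_poly0 subrr dvdp0.
- move=> c u v; rewrite !inE => Vu Vv phi.
  rewrite linearP comp_polyD comp_polyZ opprD addrACA -scalerBr.
  by apply: dvdp_add (Vv phi); rewrite -mul_polyC; apply: dvdp_mull (Vu phi).
- move=> f _ [u Vu <-] phi; exact: (Vu (phi \o f)).
Qed.

(** Letters are not in the space: sent to t, they would make t ^ (q ^ (2 n)) - t
    divide t ^ (q ^ n) - t, whose degree is smaller. *)
Lemma frobenius_fixed_proper n : inhabited X -> (0 < n)%N ->
  is_proper_Tspace (frobenius_fixed n).
Proof.
move=> [x] n_gt0; split; first exact: frobenius_fixed_Tspace.
move=> V_full.
have polyC_central (c : k) (f : {poly k}) : GRing.comm c%:A f by apply: mulrC.
have [phi phi_x] := free_algebra_universal (fun _ : X => 'X) polyC_central.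
have : frobenius_fixed n (letter k x) by rewrite V_full.
move=> /(_ phi); rewrite phi_x comp_polyX; apply/negP.
have size_sub m : (0 < m)%N -> size ('X^(q ^ m) - 'X : {poly k}) = (q ^ m).+1.
  move=> m_gt0; rewrite size_polyDl ?size_polyXn // size_polyN size_polyX ltnS.
  exact: leq_ltn_trans m_gt0 (ltn_expl m (finNzRing_gt1 k)).
have sub_neq0 : 'X^(q ^ n) - 'X != 0 :> {poly k}.
  by rewrite -size_poly_eq0 size_sub.
apply: contraTN (n_gt0) => /(dvdp_leq sub_neq0).
rewrite !size_sub ?muln_gt0 //= ltnS leq_exp2l ?finNzRing_gt1 //.
by rewrite -{2}(mul1n n) leq_pmul2r.
Qed.

(** This is the trace of the quadratic extension: the q ^ n-th power map
    exchanges its two terms modulo t ^ (q ^ (2 n)) - t. *)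
Lemma frobenius_fixed_trace n u :
  frobenius_fixed n (u + u ^+ (q ^ n)).
Proof.
move=> phi; rewrite rmorphD rmorphXn /=
  (expX_card_comp _ (phi u)) comp_polyD -comp_polyA.
rewrite comp_Xn_poly -exprM -expnD addnn -mul2n.
rewrite [phi u + _]addrC [X in _ %| X - _]addrC addrKA; apply: dvdp_XnsubX_comp.
Qed.

(** The q ^ m-th power map is the identity on the field with q ^ (2 n) elements,
    so this difference even vanishes there. *)
Lemma frobenius_fixed_sub n m u : (2 * n %| m)%N ->
  frobenius_fixed n (u - u ^+ (q ^ m)).
Proof.
move=> dvd_m phi; rewrite rmorphB rmorphXn /=.
have dvd_w : 'X^(q ^ (2 * n)) - 'X %| phi u - phi u ^+ (q ^ m).
  rewrite (expX_card_comp _ (phi u)) -dvdpNr opprB.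
  exact: dvdp_trans (dvdp_Xpow_subX _ dvd_m) (dvdp_XnsubX_comp _ _).
apply: dvdp_sub => //; rewrite -expX_card_comp.
by apply: dvdp_exp; rewrite ?expn_gt0 ?(ltnW (finNzRing_gt1 k)).
Qed.
End FrobeniusFixed.

Theorem corollary6p1 (X : choiceType) (hX : inhabited X)
    (k : finFieldType) (p : nat) (hp : p \in [pchar k]) (hp2 : (2 < p)%N) :
  infinite_set [set V : set (free_algebra k X) | is_maximal_Tspace V].
Proof.
apply: (@comaximal_infinite_maximal_Tspaces _ _ hX
  (fun i => @frobenius_fixed X k (2 ^ i))) => [i|i j lt_ij u].
  by apply: frobenius_fixed_proper; rewrite ?expn_gt0.
have two_neq0 : 2%:R != 0 :> k.
  by rewrite -(dvdn_pcharf hp) gtnNdvd.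
pose w := u ^+ (#|k| ^ (2 ^ j)).
have half_stable n v :
    @frobenius_fixed X k n v -> @frobenius_fixed X k n (2%:R^-1 *: v).
  move=> Vv; have [[V0 V_lin] _] := @frobenius_fixed_Tspace X k n.
  by have := V_lin 2%:R^-1 v 0; rewrite inE addr0 !inE in V0 *; apply.
exists (2%:R^-1 *: (u - w)).
  by apply/half_stable/frobenius_fixed_sub; rewrite -expnS dvdn_exp2l.
rewrite (_ : u - _ = 2%:R^-1 *: (u + w));
  first exact/half_stable/frobenius_fixed_trace.
apply: (scalerI two_neq0); rewrite scalerBr !scalerA divff // !scale1r.
by rewrite scaler_nat mulr2n opprB addrACA subrr addr0.
Qed.
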